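(* The map $g\mapsto g^\triangledown$ extends to a unitary map from $\ell_K^2(\mathbb Z_+)$ onto $\ell^2(\mathbb Z_+)$, and its adjoint is the map $f\mapsto f^\vartriangle$. In particular: $$(g^\triangledown)^\vartriangle=g,\quad\forall g\in\ell_K^2(\mathbb Z_+),\qquad (f^\vartriangle)^\triangledown=f,\quad\forall f\in\ell^2(\mathbb Z_+).$$
   Context: $\mathbb Z_+=\{0,1,2,\ldots\}$; $\ell^2(\mathbb Z_+)$ is the Hilbert space of real square-summable sequences on $\mathbb Z_+$; $\ell_0(\mathbb Z_+)$ is the vector space of finitely supported functions from $\mathbb Z_+$ into $\mathbb R$. For $x,y\in\mathbb Z_+$, $K(x,y)=\binom{x+y}{x}=\sum_{n=0}^{\min(x,y)}\binom{x}{n}\binom{y}{n}$, a positive definite function on $\mathbb Z_+$; the function $(-1)^{x+y}K(x,y)$ is then also positive definite. The space $\ell_0(\mathbb Z_+)$ is endowed with the inner product $$\langle f,g\rangle_K=\sum_{x=0}^\infty\sum_{y=0}^\infty(-1)^{x+y}f(x)g(y)K(x,y),$$ and $\ell_K^2(\mathbb Z_+)$ denotes the closure (completion) of $\ell_0(\mathbb Z_+)$ with respect to $\langle\cdot,\cdot\rangle_K$. For $g\in\ell_0(\mathbb Z_+)$, the transform $g^\triangledown$ is defined by $$g^\triangledown(n)=\sum_{x=n}^\infty\binom{x}{n}g(x),\qquad n\in\mathbb Z_+,$$ and for $f\in\ell_0(\mathbb Z_+)$, the transform $f^\vartriangle$ is defined by $$f^\vartriangle(x)=\sum_{y=x}^\infty(-1)^{x+y}\binom{y}{x}f(y),\qquad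 x\in\mathbb Z_+.$$
   Formalization: As printed the claim fails (g=δ_0+δ_1 has ⟨g,g⟩_K=1 but ‖g^▽‖²=5); proved instead are both corrections: the claim with (-1)^{x+y} dropped from the inner product, and the claim with the printed inner product and the transforms ▽ and △ exchanged. *)

(* Defs.v *)
From HB Require Import structures.
From mathcomp Require Import all_boot all_order all_algebra.
From mathcomp Require Import all_classical all_reals all_analysis.
From mathcomp Require Import ring lra.
Set Implicit Arguments.
Unset Strict Implicit.
Unset Printing Implicit Defensive.
Import Order.TTheory GRing.Theory Num.Theory.
Import numFieldNormedType.Exports.
Local Open Scope classical_set_scope.
Local Open Scope ring_scope.

Section FinitelySupported.
Variable R : realType.

Definition fin_supp : {pred nat -> R} :=
  [pred f : nat -> R | `[< exists N, forall n, (N <= n)%N -> f n = 0 >]].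

Lemma fin_suppP (f : nat -> R) :
  reflect (exists N, forall n, (N <= n)%N -> f n = 0) (f \in fin_supp).
Proof. exact: asboolP. Qed.

Lemma fin_supp_submod_closed : submod_closed fin_supp.
Proof.
split; first by apply/fin_suppP; exists 0%N.
move=> a f g /fin_suppP[N fN] /fin_suppP[M gM]; apply/fin_suppP.
exists (maxn N M) => n; rewrite geq_max => /andP[Nn Mn].
by rewrite !fctE fN// gM// scaler0 addr0.
Qed.

HB.instance Definition _ :=
  GRing.isSubmodClosed.Build R (nat -> R) fin_supp fin_supp_submod_closed.

Definition l0 : predArgType := {f : nat -> R | f \in fin_supp}.
HB.instance Definition _ := SubChoice.on l0.
HB.instance Definition _ := [SubChoice_isSubLmodule of l0 by <:].

Definition l0_fun (f : l0) : nat -> R := val f.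
Coercion l0_fun : l0 >-> Funclass.

Lemma l0P (f : l0) : exists N, forall n, (N <= n)%N -> f n = 0.
Proof. exact/fin_suppP/(valP f). Qed.

Lemma l0_linear a (f g : l0) n : (a *: f + g : l0) n = a * f n + g n.
Proof. by []. Qed.

Lemma l0_inj (f g : l0) : (forall n, f n = g n) -> f = g.
Proof. by move=> fg; apply: val_inj; apply/funext. Qed.

Lemma fsbig_bounded (P : set nat) (F : nat -> R) N :
  (forall n, (N <= n)%N -> F n = 0) -> (forall n, ~ P n -> F n = 0) ->
  \sum_(i \in P) F i = \sum_(i < N) F i.
Proof.
move=> FN FP; rewrite fsbig_ord [LHS]fsbig_mkcond [RHS](fsbig_mkcond _ `I_N).
apply: eq_fsbigr => n _; rewrite !patchE /=.
case: ifPn => nP; case: ifPn => // nN.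
  by rewrite FN// leqNgt; apply: contraNN nN => nN; rewrite inE.
by rewrite FP// => nP'; move: nP; rewrite mem_set.
Qed.

(* [\sum_(i \in A)] over a classical set sums the finitely many nonzero terms;
   every sum below has finite support because its argument lies in [l0]. *)
Definition nabla_fun (g : nat -> R) (n : nat) : R :=
  \sum_(x \in [set x | (n <= x)%N]) 'C(x, n)%:R * g x.

Definition delta_fun (f : nat -> R) (x : nat) : R :=
  \sum_(y \in [set y | (x <= y)%N]) (-1) ^+ (x + y) * 'C(y, x)%:R * f y.

Lemma nabla_funE (g : nat -> R) N n : (forall x, (N <= x)%N -> g x = 0) ->
  nabla_fun g n = \sum_(x < N) 'C(x, n)%:R * g x.
Proof.
move=> gN; apply: (@fsbig_bounded _ (fun x => 'C(x, n)%:R * g x)) => x.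
  by move/gN => ->; rewrite mulr0.
by move=> /negP; rewrite -ltnNge => xn; rewrite bin_small ?mul0r.
Qed.

Lemma delta_funE (f : nat -> R) N x : (forall y, (N <= y)%N -> f y = 0) ->
  delta_fun f x = \sum_(y < N) (-1) ^+ (x + y) * 'C(y, x)%:R * f y.
Proof.
move=> fN.
apply: (@fsbig_bounded _ (fun y => (-1) ^+ (x + y) * 'C(y, x)%:R * f y)) => y.
  by move/fN => ->; rewrite mulr0.
by move=> /negP; rewrite -ltnNge => xn; rewrite bin_small ?mulr0 ?mul0r.
Qed.

Lemma nabla_fin_supp (g : l0) : nabla_fun g \in fin_supp.
Proof.
apply/fin_suppP; have [N gN] := l0P g; exists N => n Nn.
rewrite (nabla_funE _ gN) big1// => -[x xN] _ /=.
by rewrite bin_small ?mul0r// (leq_trans xN).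
Qed.

Lemma delta_fin_supp (f : l0) : delta_fun f \in fin_supp.
Proof.
apply/fin_suppP; have [N fN] := l0P f; exists N => n Nn.
rewrite (delta_funE _ fN) big1// => -[x xN] _ /=.
by rewrite bin_small ?mulr0 ?mul0r// (leq_trans xN).
Qed.

Definition nabla (g : l0) : l0 := exist _ (nabla_fun g) (nabla_fin_supp g).
Definition delta (f : l0) : l0 := exist _ (delta_fun f) (delta_fin_supp f).

Lemma nablaE (f : l0) n : nabla f n = nabla_fun f n. Proof. by []. Qed.

Lemma deltaE (f : l0) n : delta f n = delta_fun f n. Proof. by []. Qed.

Definition binomial_kernel (x y : nat) : R := 'C(x + y, x)%:R.

Definition binomial_form (f g : l0) : R :=
  \sum_(x \in [set: nat]) \sum_(y \in [set: nat])
    f x * g y * binomial_kernel x y.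

(* This form is the unsigned one transported by [f x |-> (-1)^x f x], hence
   [alt_binomial_form f g = \sum_n delta f n * delta g n], whereas
   [binomial_form f g = \sum_n nabla f n * nabla g n]: each of the two forms is
   the one for which one of the two transforms is isometric. *)
Definition alt_binomial_form (f g : l0) : R :=
  \sum_(x \in [set: nat]) \sum_(y \in [set: nat])
    (-1) ^+ (x + y) * f x * g y * binomial_kernel x y.

Lemma binomial_kernelE N x y : (x < N)%N ->
  binomial_kernel x y = \sum_(n < N) 'C(x, n)%:R * 'C(y, n)%:R.
Proof.
move=> xN; rewrite /binomial_kernel addnC -binomial.Vandermonde natr_sum.
rewrite (big_ord_widen _ (fun j => ('C(y, j) * 'C(x, x - j))%:R) xN).
rewrite big_mkcond; apply: eq_bigr => -[n nN] _ /=; case: ifPn.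
  by rewrite ltnS => nx; rewrite bin_sub// natrM mulrC.
by rewrite -leqNgt => xn; rewrite bin_small// mul0r.
Qed.

Lemma l0_bound2 (f g : l0) : exists N,
  (forall n, (N <= n)%N -> f n = 0) /\ (forall n, (N <= n)%N -> g n = 0).
Proof.
have [N fN] := l0P f; have [M gM] := l0P g; exists (maxn N M).
by split=> n; rewrite geq_max => /andP[/fN ? /gM ?].
Qed.

Lemma double_fsum N (f g : l0) (c : nat -> nat -> R) :
  (forall n, (N <= n)%N -> f n = 0) -> (forall n, (N <= n)%N -> g n = 0) ->
  \sum_(x \in [set: nat]) \sum_(y \in [set: nat]) f x * g y * c x y =
  \sum_(x < N) \sum_(y < N) f x * g y * c x y.
Proof.
move=> fN gN.
have s1 n : (N <= n)%N -> \sum_(y \in [set: nat]) f n * g y * c n y = 0.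
  by move=> Nn; rewrite fsbig1// => y _; rewrite fN// !mul0r.
rewrite (fsbig_bounded s1); last by move=> n /(_ I).
apply: eq_bigr => x _; apply: (@fsbig_bounded _ (fun y => f x * g y * c x y)) => n.
  by move=> Nn; rewrite gN// mulr0 mul0r.
by move=> /(_ I).
Qed.

Lemma binomial_formE N (f g : l0) :
  (forall n, (N <= n)%N -> f n = 0) -> (forall n, (N <= n)%N -> g n = 0) ->
  binomial_form f g = \sum_(n < N) nabla f n * nabla g n.
Proof.
move=> fN gN; rewrite /binomial_form (double_fsum _ fN gN).
under [RHS]eq_bigr => n _ do
  rewrite !nablaE (nabla_funE _ fN) (nabla_funE _ gN) big_distrlr /=.
rewrite [RHS]exchange_big /=; apply: eq_bigr => -[x xN] _.
rewrite [RHS]exchange_big /=; apply: eq_bigr => y _.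
rewrite (binomial_kernelE _ xN) mulr_sumr; apply: eq_bigr => n _ /=.
by rewrite [RHS]mulrACA [LHS]mulrC.
Qed.

Lemma nabla_is_linear : linear nabla.
Proof.
move=> a f g; apply: l0_inj => n; rewrite l0_linear.
have [N [fN gN]] := l0_bound2 f g.
rewrite !nablaE (nabla_funE _ fN) (nabla_funE _ gN).
rewrite (@nabla_funE _ N); last first.
  by move=> x Nx; rewrite (l0_linear a f g) fN// gN// mulr0 addr0.
rewrite mulr_sumr -big_split /=; apply: eq_bigr => x _.
by rewrite (l0_linear a f g) mulrDr mulrCA.
Qed.
HB.instance Definition _ := GRing.isLinear.Build R l0 l0 _ nabla nabla_is_linear.

Lemma delta_is_linear : linear delta.
Proof.
move=> a f g; apply: l0_inj => n; rewrite l0_linear.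
have [N [fN gN]] := l0_bound2 f g.
rewrite !deltaE (delta_funE _ fN) (delta_funE _ gN).
rewrite (@delta_funE _ N); last first.
  by move=> x Nx; rewrite (l0_linear a f g) fN// gN// mulr0 addr0.
rewrite mulr_sumr -big_split /=; apply: eq_bigr => x _.
by rewrite (l0_linear a f g) mulrDr mulrCA.
Qed.
HB.instance Definition _ := GRing.isLinear.Build R l0 l0 _ delta delta_is_linear.

Lemma binomial_formC (f g : l0) : binomial_form f g = binomial_form g f.
Proof.
have [N [fN gN]] := l0_bound2 f g.
by rewrite !(@binomial_formE N)//; apply: eq_bigr => n _; rewrite mulrC.
Qed.

Lemma binomial_form_linear (g : l0) : scalar (binomial_form^~ g).
Proof.
move=> a f1 f2 /=; have [N [f1N f2N]] := l0_bound2 f1 f2.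
have [M gM] := l0P g.
have b (h : l0) (K : nat) : (K <= maxn N M)%N ->
    (forall n, (K <= n)%N -> h n = 0) ->
    forall n, (maxn N M <= n)%N -> h n = 0.
  by move=> KNM hK n NMn; apply: hK; exact: leq_trans NMn.
have {}f1N := b _ _ (leq_maxl _ _) f1N.
have {}f2N := b _ _ (leq_maxl _ _) f2N.
have {}gM := b _ _ (leq_maxr _ _) gM.
rewrite !(@binomial_formE (maxn N M))//; last first.
  by move=> n Nn; rewrite l0_linear f1N// f2N// mulr0 addr0.
rewrite mulr_sumr -big_split; apply: eq_bigr => n _ /=.
by rewrite linearP l0_linear mulrDl mulrA.
Qed.

Lemma binomial_form_bilinear : bilinear_for *%R (idfun \; *%R) binomial_form.
Proof.
split=> [u|u] a f g; first exact: binomial_form_linear.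
by rewrite [LHS]binomial_formC binomial_form_linear !(binomial_formC u).
Qed.

Lemma binomial_form_gt0 (f : l0) : f != 0 -> 0 < binomial_form f f.
Proof.
have [N fN] := l0P f; rewrite (@binomial_formE N)// => f0.
rewrite lt_neqAle sumr_ge0 ?andbT; last by move=> n _; rewrite -expr2 sqr_ge0.
apply: contraNN f0; rewrite eq_sym psumr_eq0; last first.
  by move=> n _; rewrite -expr2 sqr_ge0.
move=> /allP nf0; apply/eqP/l0_inj => n; rewrite [RHS]/(0 : R).
suff H k : forall n, (N <= n + k)%N -> f n = 0 by apply: (H N); rewrite leq_addl.
elim: k => [|k IH] {}n; first by rewrite addn0; exact: fN.
rewrite addnS leq_eqVlt => /orP[/eqP Nnk|]; last by rewrite ltnS; exact: IH.
have nN : (n < N)%N by rewrite Nnk ltnS leq_addr.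
have /implyP/(_ erefl) := nf0 (Ordinal nN) (mem_index_enum _).
rewrite -expr2 sqrf_eq0 /= /nabla /l0_fun /= (nabla_funE _ fN).
rewrite (bigD1 (Ordinal nN))//= binn mul1r big1 ?addr0; first by move/eqP.
move=> [x xN]; rewrite -val_eqE /= => xn.
have [xn'|nx] := ltnP x n; first by rewrite bin_small ?mul0r.
rewrite IH ?mulr0// Nnk -addSn leq_add2r ltn_neqAle nx andbT.
by rewrite eq_sym.
Qed.

HB.instance Definition _ := bilinear_isBilinear.Build R l0 l0 R *%R
  (idfun \; *%R) binomial_form binomial_form_bilinear.
HB.instance Definition _ := isHermitianSesquilinear.Build R l0 false idfun
  binomial_form (fun f g : l0 => etrans (binomial_formC f g) (esym (mul1r _))).
HB.instance Definition _ := isDotProduct.Build R l0 binomial_form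
  binomial_form_gt0.

Fact flip_fin_supp (f : l0) : (fun x => (-1) ^+ x * f x) \in fin_supp.
Proof.
by have [N fN] := l0P f; apply/fin_suppP; exists N => n /fN ->; rewrite mulr0.
Qed.

Definition flip (f : l0) : l0 :=
  exist _ (fun x => (-1) ^+ x * f x) (flip_fin_supp f).

Lemma flipE (f : l0) x : flip f x = (-1) ^+ x * f x. Proof. by []. Qed.

Lemma flip_is_linear : linear flip.
Proof.
move=> a f g; apply: l0_inj => n; rewrite l0_linear.
by rewrite !flipE (l0_linear a f g) mulrDr mulrCA.
Qed.
HB.instance Definition _ := GRing.isLinear.Build R l0 l0 _ flip flip_is_linear.

Lemma flipK : involutive flip.
Proof. by move=> f; apply: l0_inj => n; rewrite !flipE signrMK. Qed.

Lemma alt_binomial_formE (f g : l0) :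
  alt_binomial_form f g = binomial_form (flip f) (flip g).
Proof.
apply: eq_fsbigr => x _; apply: eq_fsbigr => y _.
by rewrite !flipE mulrACA exprD !mulrA.
Qed.

Lemma alt_binomial_formC (f g : l0) : alt_binomial_form f g = alt_binomial_form g f.
Proof. by rewrite !alt_binomial_formE binomial_formC. Qed.

Lemma alt_binomial_form_bilinear :
  bilinear_for *%R (idfun \; *%R) alt_binomial_form.
Proof.
have lin u : scalar (alt_binomial_form^~ u).
  by move=> a f g /=; rewrite !alt_binomial_formE linearP /= binomial_form_linear.
split=> [u|u] a f g; first exact: lin.
by rewrite [LHS]alt_binomial_formC lin !(alt_binomial_formC u).
Qed.

Lemma alt_binomial_form_gt0 (f : l0) : f != 0 -> 0 < alt_binomial_form f f.
Proof.
move=> f0; rewrite alt_binomial_formE binomial_form_gt0//.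
by apply: contraNN f0 => /eqP ff; rewrite -(flipK f) ff linear0.
Qed.

HB.instance Definition _ := bilinear_isBilinear.Build R l0 l0 R *%R
  (idfun \; *%R) alt_binomial_form alt_binomial_form_bilinear.
HB.instance Definition _ := isHermitianSesquilinear.Build R l0 false idfun
  alt_binomial_form
  (fun f g : l0 => etrans (alt_binomial_formC f g) (esym (mul1r _))).
HB.instance Definition _ := isDotProduct.Build R l0 alt_binomial_form
  alt_binomial_form_gt0.

End FinitelySupported.
Section DotNorm.
Variables (R : realType) (V : lmodType R) (form : {dot V for idfun}).
Implicit Types u v w : V.

Definition dot_norm v : R := Num.sqrt (form v v).

Lemma dotC u v : form u v = form v u.
Proof. by rewrite (@hermC _ false idfun _ form) mul1r. Qed.

Lemma dotDl u v w : form (u + v) w = form u w + form v w.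
Proof. exact: linearDl. Qed.

Lemma dotDr u v w : form w (u + v) = form w u + form w v.
Proof. exact: linearDr. Qed.

Lemma dotZl a v w : form (a *: v) w = a * form v w.
Proof. exact: linearZl_LR. Qed.

Lemma dotZr a v w : form w (a *: v) = a * form w v.
Proof. exact: linearZr_LR. Qed.

Lemma dotBl u v w : form (u - v) w = form u w - form v w.
Proof. exact: linearBl. Qed.

Lemma dotBr u v w : form w (u - v) = form w u - form w v.
Proof. exact: linearBr. Qed.

Lemma dot_ge0 v : 0 <= form v v.
Proof.
have [->|v0] := eqVneq v 0; first by rewrite linear0r.
exact/ltW/neq0_dnorm_gt0.
Qed.

Lemma dot_eq0 v : form v v = 0 -> v = 0.
Proof.
by move=> fv; apply: contra_eq fv => /neq0_dnorm_gt0 h; rewrite gt_eqF.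
Qed.

Lemma dot_normE v : dot_norm v ^+ 2 = form v v.
Proof. by rewrite sqr_sqrtr// dot_ge0. Qed.

Lemma dot_norm_ge0 v : 0 <= dot_norm v.
Proof. exact: sqrtr_ge0. Qed.

Lemma dotBB a u v :
  form (u - a *: v) (u - a *: v) =
  form u u - 2 * a * form u v + a ^+ 2 * form v v.
Proof.
by rewrite !(dotBl, dotBr, dotZl, dotZr) (dotC v u); ring.
Qed.

Lemma dot_CauchySchwarz u v : form u v <= dot_norm u * dot_norm v.
Proof.
have [v0|v0] := eqVneq v 0.
  by rewrite v0 linear0r mulr_ge0// dot_norm_ge0.
have vv : 0 < form v v by exact: neq0_dnorm_gt0.
rewrite -sqrtrM ?dot_ge0//; apply: (le_trans (ler_norm _)).
rewrite -sqrtr_sqr ler_wsqrtr//.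
have := dot_ge0 (u - (form u v / form v v) *: v); rewrite dotBB => h.
rewrite -subr_ge0.
have -> : form u u * form v v - form u v ^+ 2 =
  form v v * (form u u - 2 * (form u v / form v v) * form u v +
               (form u v / form v v) ^+ 2 * form v v).
  by field; rewrite gt_eqF.
by rewrite mulr_ge0// ltW.
Qed.

Lemma dot_normD u v : dot_norm (u + v) <= dot_norm u + dot_norm v.
Proof.
rewrite -[leRHS]ger0_norm ?addr_ge0 ?dot_norm_ge0// -sqrtr_sqr ler_wsqrtr//.
rewrite dotDl !dotDr sqrrD !dot_normE (dotC v u).
by have := dot_CauchySchwarz u v; lra.
Qed.

Lemma dot_normZ a v : dot_norm (a *: v) = `|a| * dot_norm v.
Proof.
rewrite /dot_norm dotZl dotZr mulrA -expr2.
by rewrite sqrtrM ?sqr_ge0// sqrtr_sqr.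
Qed.

Lemma dot_norm0 : dot_norm 0 = 0.
Proof. by rewrite /dot_norm linear0r sqrtr0. Qed.

Lemma dot_normB u v : dot_norm (u - v) = dot_norm (v - u).
Proof.
have -> : u - v = -1 *: (v - u) by rewrite scaleN1r opprB.
by rewrite dot_normZ normrN1 mul1r.
Qed.

Lemma dot_norm_dist u v : `|dot_norm u - dot_norm v| <= dot_norm (u - v).
Proof.
have := dot_normD (u - v) v; have := dot_normD (v - u) u.
by rewrite !subrK (dot_normB v u) ler_norml => ? ?; apply/andP; split; lra.
Qed.

Lemma dot_polarization u v :
  form u v = (dot_norm (u + v) ^+ 2 - dot_norm (u - v) ^+ 2) / 4.
Proof.
rewrite !dot_normE dotBl dotDl !dotBr !dotDr (dotC v u).
by field.
Qed.

End DotNorm.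

Section Completion.
Variables (R : realType) (V : lmodType R) (form : {dot V for idfun}).
Local Notation norm := (dot_norm form).

Definition cauchy_seqs : {pred nat -> V} := [pred x : nat -> V |
  `[< forall e : R, 0 < e -> exists N, forall m n,
        (N <= m)%N -> (N <= n)%N -> norm (x m - x n) < e >]].

Lemma cauchy_seqs_submod_closed : submod_closed cauchy_seqs.
Proof.
split=> [|a x y /asboolP xC /asboolP yC].
  by apply/asboolP => e e0; exists 0%N => m n _ _; rewrite subrr dot_norm0.
apply/asboolP => e e0.
have a0 : 0 < `|a| + 1 by rewrite ltr_wpDl.
have e2 : 0 < e / 2 by rewrite divr_gt0.
have [N xN] := xC (e / 2 / (`|a| + 1)) (divr_gt0 e2 a0).
have [M yM] := yC (e / 2) e2.
exists (maxn N M) => m n; rewrite !geq_max => /andP[Nm Mm] /andP[Nn Mn].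
rewrite !fctE opprD addrACA -scalerBr (splitr e).
apply: (le_lt_trans (dot_normD _ _ _)).
rewrite ler_ltD ?yM// dot_normZ.
have := xN _ _ Nm Nn; rewrite ltr_pdivlMr// mulrC => /ltW; apply: le_trans.
by rewrite ler_wpM2r ?dot_norm_ge0// lerDl.
Qed.

HB.instance Definition _ := GRing.isSubmodClosed.Build R (nat -> V)
  cauchy_seqs cauchy_seqs_submod_closed.

Definition cauchySeq : predArgType := {x : nat -> V | x \in cauchy_seqs}.
HB.instance Definition _ := SubChoice.on cauchySeq.
HB.instance Definition _ := [SubChoice_isSubLmodule of cauchySeq by <:].

Definition null_seqs : {pred cauchySeq} :=
  [pred x : cauchySeq | `[< norm (val x n) @[n --> \oo] --> (0 : R) >]].

Lemma null_seqsZD a (x y : cauchySeq) :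
  x \in null_seqs -> y \in null_seqs -> a *: x + y \in null_seqs.
Proof.
move=> /asboolP x0 /asboolP y0; apply/asboolP.
have h : `|a| * norm (val x n) + norm (val y n) @[n --> \oo] --> (0 : R).
  by rewrite -[X in _ --> X]addr0 -[X in X + _](mulr0 `|a|); apply: cvgD => //;
    apply: cvgMl_tmp.
apply: (squeeze_cvgr _ (cvg_cst 0) h); near=> n.
by rewrite dot_norm_ge0 -dot_normZ dot_normD.
Unshelve. all: by end_near. Qed.

Lemma null_seqs0 : 0 \in null_seqs.
Proof.
apply/asboolP; rewrite (_ : (fun n => _) = cst 0); first exact: cvg_cst.
by apply/funext => n; rewrite dot_norm0.
Qed.

Lemma null_seqs_zmod_closed : zmod_closed null_seqs.
Proof.
split=> [|x y x0 y0]; first exact: null_seqs0.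
by rewrite -scaleN1r addrC null_seqsZD.
Qed.

HB.instance Definition _ := GRing.isZmodClosed.Build cauchySeq
  null_seqs null_seqs_zmod_closed.

(* Cauchy sequences of [V] modulo sequences of norm tending to 0, with the inner
   product extended by [comp_form]; see [embed_isometry], [embed_dense] and
   [completion_complete]. *)
Definition completion : Type := Quotient.quot null_seqs.
HB.instance Definition _ := GRing.Zmodule.on completion.

Definition cauchy_class (x : cauchySeq) : completion :=
  generic_quotient.pi (Quotient.quot null_seqs) x.

Definition representative (X : completion) : cauchySeq :=
  generic_quotient.repr (X : Quotient.quot null_seqs).

Lemma representativeK X : cauchy_class (representative X) = X.
Proof. exact: generic_quotient.reprK. Qed.

Lemma class_eq x y : (cauchy_class x = cauchy_class y) <-> (x - y \in null_seqs).
Proof.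
rewrite Quotient.idealrBE; split; first by move=> h; apply/eqP.
by move=> /eqP.
Qed.

Lemma classD x y : cauchy_class (x + y) = cauchy_class x + cauchy_class y.
Proof. exact: ring_quotient.pi_addr. Qed.

Lemma class_surj X : exists x, cauchy_class x = X.
Proof. by exists (representative X); exact: representativeK. Qed.

Definition comp_scale (a : R) (X : completion) : completion :=
  cauchy_class (a *: representative X).

Lemma class_scale a x : cauchy_class (a *: x) = comp_scale a (cauchy_class x).
Proof.
apply/class_eq; rewrite -scalerBr -[X in X \in _]addr0 null_seqsZD ?null_seqs0//.
by apply/class_eq; rewrite representativeK.
Qed.

Lemma comp_scaleA a b X : comp_scale a (comp_scale b X) = comp_scale (a * b) X.
Proof. by have [x <-] := class_surj X; rewrite -!class_scale scalerA. Qed.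

Lemma comp_scale1 X : comp_scale 1 X = X.
Proof. by have [x <-] := class_surj X; rewrite -!class_scale scale1r. Qed.

Lemma comp_scaleDr a X Y :
  comp_scale a (X + Y) = comp_scale a X + comp_scale a Y.
Proof.
have [x <-] := class_surj X; have [y <-] := class_surj Y.
by rewrite -classD -!class_scale -classD scalerDr.
Qed.

Lemma comp_scaleDl X a b : comp_scale (a + b) X = comp_scale a X + comp_scale b X.
Proof.
by have [x <-] := class_surj X; rewrite -!class_scale -classD scalerDl.
Qed.

HB.instance Definition _ := GRing.Zmodule_isLmodule.Build R completion
  comp_scaleA comp_scale1 comp_scaleDr comp_scaleDl.

Lemma class_is_linear : linear cauchy_class.
Proof. by move=> a x y; rewrite classD class_scale. Qed.
HB.instance Definition _ := GRing.isLinear.Build R cauchySeq completion _ cauchy_class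
  class_is_linear.

Fact const_cauchy (v : V) : (fun _ : nat => v) \in cauchy_seqs.
Proof. by apply/asboolP => e e0; exists 0%N => m n _ _; rewrite subrr dot_norm0. Qed.

Definition embed (v : V) : completion :=
  cauchy_class (exist _ (fun _ : nat => v) (const_cauchy v)).

Lemma embed_is_linear : linear embed.
Proof.
move=> a u v; rewrite /embed -linearP; congr cauchy_class; exact: val_inj.
Qed.
HB.instance Definition _ := GRing.isLinear.Build R V completion _ embed
  embed_is_linear.

Definition comp_form (X Y : completion) : R :=
  limn (fun n => form (val (representative X) n) (val (representative Y) n)).

Lemma cauchySeqP (x : cauchySeq) (e : R) : 0 < e -> exists N, forall m n,
  (N <= m)%N -> (N <= n)%N -> norm (val x m - val x n) < e.
Proof. by move=> e0; have /asboolP := valP x; exact. Qed.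

Lemma norm_is_cvg (x : cauchySeq) : cvgn (fun n => norm (val x n)).
Proof.
apply/cauchy_cvgP/cauchy_exP => e e0; have [N xN] := cauchySeqP x e0.
exists (norm (val x N)), N => // n /= Nn.
by rewrite /ball /=; apply: (le_lt_trans (dot_norm_dist _ _ _)); exact: xN.
Qed.

Lemma norm_lim_eq (x y : cauchySeq) : cauchy_class x = cauchy_class y ->
  limn (fun n => norm (val x n)) = limn (fun n => norm (val y n)).
Proof.
move=> /class_eq/asboolP xy0; apply/eqP; rewrite -subr_eq0; apply/eqP.
rewrite -limB; [|exact: norm_is_cvg|exact: norm_is_cvg].
apply/cvg_lim => //; apply/norm_cvg0P.
apply: (squeeze_cvgr _ (cvg_cst 0) xy0); near=> n.
by rewrite normr_ge0/=; exact: dot_norm_dist.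
Unshelve. all: by end_near. Qed.

Lemma form_cvg_polar (x y : cauchySeq) :
  form (val x n) (val y n) @[n --> \oo] -->
  (limn (fun n => norm (val (x + y) n)) ^+ 2
   - limn (fun n => norm (val (x - y) n)) ^+ 2) / 4.
Proof.
under eq_fun do rewrite dot_polarization.
have sq (z : cauchySeq) :
    norm (val z n) ^+ 2 @[n --> \oo] --> limn (fun n => norm (val z n)) ^+ 2.
  by have h := @norm_is_cvg z; exact: (cvgM h h).
by apply: cvgMr_tmp; apply: cvgB; [exact: (@sq (x + y))|exact: (@sq (x - y))].
Qed.

Lemma comp_form_cvg (x y : cauchySeq) :
  form (val x n) (val y n) @[n --> \oo] --> comp_form (cauchy_class x) (cauchy_class y).
Proof.
suff -> : comp_form (cauchy_class x) (cauchy_class y) =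
  (limn (fun n => norm (val (x + y) n)) ^+ 2
   - limn (fun n => norm (val (x - y) n)) ^+ 2) / 4 by exact: form_cvg_polar.
rewrite /comp_form (cvg_lim _ (@form_cvg_polar _ _))//.
by congr ((_ ^+ 2 - _ ^+ 2) / 4); apply: norm_lim_eq;
  rewrite ?linearB ?linearD/= !representativeK.
Qed.

Lemma comp_formC X Y : comp_form X Y = comp_form Y X.
Proof. by rewrite /comp_form; under eq_fun do rewrite dotC. Qed.

Lemma comp_form_linear Y : scalar (comp_form^~ Y).
Proof.
move=> a X1 X2; have [x1 <-] := class_surj X1; have [x2 <-] := class_surj X2.
have [y <-] := class_surj Y; rewrite -linearP.
apply: (cvg_unique _ (@comp_form_cvg _ _)) => //.
rewrite (_ : (fun n => _) =
  (fun n => a * form (val x1 n) (val y n) + form (val x2 n) (val y n))); last first.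
  by apply/funext => n; rewrite -dotZl -dotDl.
by apply: cvgD; [apply: cvgMl_tmp|]; exact: comp_form_cvg.
Qed.

Lemma comp_form_bilinear : bilinear_for *%R (idfun \; *%R) comp_form.
Proof.
split=> [u|u] a f g; first exact: comp_form_linear.
by rewrite [LHS]comp_formC comp_form_linear !(comp_formC u).
Qed.

Lemma comp_form_gt0 X : X != 0 -> 0 < comp_form X X.
Proof.
have [x <-] := class_surj X; apply: contraNT; rewrite -leNgt => xle0.
have x0 : comp_form (cauchy_class x) (cauchy_class x) = 0.
  apply/eqP; rewrite eq_le xle0 /=; rewrite -(cvg_lim _ (@comp_form_cvg x x))//.
  apply: limr_ge; first exact: (cvgP _ (@comp_form_cvg x x)).
  by near=> n; exact: dot_ge0.
apply/eqP; rewrite -(linear0 cauchy_class); apply/class_eq; rewrite subr0.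
apply/asboolP; rewrite -[X in _ --> X](sqrtr0).
have := @comp_form_cvg x x; rewrite x0 => h.
exact: (continuous_cvg _ (@sqrt_continuous R 0) h).
Unshelve. all: by end_near. Qed.

HB.instance Definition _ := bilinear_isBilinear.Build R completion completion R
  *%R (idfun \; *%R) comp_form comp_form_bilinear.
HB.instance Definition _ := isHermitianSesquilinear.Build R completion false
  idfun comp_form
  (fun X Y : completion => etrans (comp_formC X Y) (esym (mul1r _))).
HB.instance Definition _ := isDotProduct.Build R completion comp_form
  comp_form_gt0.

Lemma embed_isometry : isometry comp_form form embed.
Proof.
pose c w : cauchySeq := exist _ (fun=> w) (const_cauchy w).
move=> u v; apply: (cvg_unique _ (@comp_form_cvg (c u) (c v))) => //=.
exact: cvg_cst.
Qed.

Lemma embed_dense (X : completion) (e : R) : 0 < e ->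
  exists v, dot_norm comp_form (X - embed v) < e.
Proof.
have [x <-] := class_surj X => e0; have e2 : 0 < e / 2 by rewrite divr_gt0.
have [N xN] := cauchySeqP x e2; exists (val x N).
pose c : cauchySeq := exist _ (fun=> val x N) (const_cauchy (val x N)).
rewrite -[embed _]/(cauchy_class c) -linearB.
apply: (@le_lt_trans _ _ (e / 2)); last by rewrite ltr_pdivrMr// ltr_pMr// ltr1n.
rewrite -[leRHS]ger0_norm ?(ltW e2)// -sqrtr_sqr ler_wsqrtr//.
have h := @comp_form_cvg (x - c) (x - c).
change (comp_form (cauchy_class (x - c)) (cauchy_class (x - c)) <= (e / 2) ^+ 2).
rewrite -(cvg_lim _ h)//; apply: limr_le; first exact: (cvgP _ h).
near=> n; rewrite -dot_normE ler_sqr ?nnegrE ?dot_norm_ge0 ?(ltW e2)//.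
by apply/ltW/xN => //; near: n; exact: nbhs_infty_ge.
Unshelve. all: by end_near. Qed.

Lemma completion_complete (X : nat -> completion) :
  (forall e : R, 0 < e -> exists N, forall m n,
     (N <= m)%N -> (N <= n)%N -> dot_norm comp_form (X m - X n) < e) ->
  exists Y, dot_norm comp_form (X n - Y) @[n --> \oo] --> (0 : R).
Proof.
move=> XC.
have inv0 (n : nat) : 0 < n.+1%:R^-1 :> R by rewrite invr_gt0.
have /choice[v Xv] : forall n, exists v,
    dot_norm comp_form (X n - embed v) < n.+1%:R^-1.
  by move=> n; exact: embed_dense.
have small (e : R) : 0 < e -> exists N, forall n, (N <= n)%N -> n.+1%:R^-1 < e.
  move=> e0; have [N _ HN] := near_infty_natSinv_lt (PosNum e0).
  by exists N => n Nn; exact: HN.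
have vC : v \in cauchy_seqs.
  apply/asboolP => e e0; have e3 : 0 < e / 3 by rewrite divr_gt0.
  have [N XN] := XC _ e3; have [M hM] := small _ e3.
  exists (maxn N M) => m n; rewrite !geq_max => /andP[Nm Mm] /andP[Nn Mn].
  have -> : norm (v m - v n) = dot_norm comp_form (embed (v m) - embed (v n)).
    by rewrite -linearB /dot_norm embed_isometry.
  have -> : embed (v m) - embed (v n) =
      (embed (v m) - X m) + ((X m - X n) + (X n - embed (v n))).
    by rewrite !addrA !subrK.
  have h1 := dot_normD comp_form (embed (v m) - X m)
    ((X m - X n) + (X n - embed (v n))).
  have h2 := dot_normD comp_form (X m - X n) (X n - embed (v n)).
  rewrite (dot_normB comp_form (embed _)) in h1.
  have vm := lt_trans (Xv m) (hM _ Mm); have vn := lt_trans (Xv n) (hM _ Mn).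
  have Xmn := XN _ _ Nm Nn; apply: (le_lt_trans h1).
  rewrite [ltRHS](_ : e = e / 3 + (e / 3 + e / 3)); last by field.
  by rewrite ltrD// (le_lt_trans h2)// ltrD.
pose c : cauchySeq := exist _ v vC; exists (cauchy_class c).
apply/cvgrPdist_lt => e e0; have e3 : 0 < e / 3 by rewrite divr_gt0.
have [N vN] := cauchySeqP c e3; have [M hM] := small _ e3.
exists (maxn N M) => // n /=; rewrite geq_max => /andP[Nn Mn].
rewrite sub0r normrN ger0_norm ?dot_norm_ge0//.
have := dot_normD comp_form (X n - embed (v n)) (embed (v n) - cauchy_class c).
rewrite addrA subrK => h.
suff : dot_norm comp_form (embed (v n) - cauchy_class c) <= e / 3.
  move=> le3; apply: (le_lt_trans h); have vn := lt_trans (Xv n) (hM _ Mn).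
  apply: (@lt_trans _ _ (e / 3 + e / 3)); first by rewrite ltr_leD.
  by lra.
pose d : cauchySeq := exist _ (fun=> v n) (const_cauchy (v n)).
rewrite -[embed _]/(cauchy_class d) -linearB.
rewrite -[leRHS]ger0_norm ?(ltW e3)// -sqrtr_sqr ler_wsqrtr//.
have hc := @comp_form_cvg (d - c) (d - c).
change (comp_form (cauchy_class (d - c)) (cauchy_class (d - c)) <= (e / 3) ^+ 2).
rewrite -(cvg_lim _ hc)//; apply: limr_le; first exact: (cvgP _ hc).
near=> k; rewrite -dot_normE ler_sqr ?nnegrE ?dot_norm_ge0 ?(ltW e3)//.
by apply/ltW/vN => //; near: k; exact: nbhs_infty_ge.
Unshelve. all: by end_near. Qed.

End Completion.

Section SquareSummable.
Variable R : realType.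

Definition square_summable : {pred nat -> R} :=
  [pred u : nat -> R | `[< cvgn (series (fun n => u n ^+ 2)) >]].

Lemma square_summable_submod_closed : submod_closed square_summable.
Proof.
split=> [|a u v /asboolP uS /asboolP vS]; apply/asboolP.
  rewrite (_ : series _ = cst 0); first exact: is_cvg_cst.
  by apply/funext => n; rewrite /series /= big1// => i _; rewrite expr0n.
have cS : cvgn (series (fun n => 2 * a ^+ 2 * u n ^+ 2 + 2 * v n ^+ 2)).
  exact: (is_cvg_seriesD (@is_cvg_seriesZ _ _ (2 * a ^+ 2) uS)
                         (@is_cvg_seriesZ _ _ 2 vS)).
apply: series_le_cvg cS => n; first exact: sqr_ge0.
  have := sqr_ge0 a; have := sqr_ge0 (u n); have := sqr_ge0 (v n). nra.
rewrite -subr_ge0 -[(a *: u + v) n]/(a * u n + v n).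
have -> : 2 * a ^+ 2 * u n ^+ 2 + 2 * v n ^+ 2 - (a * u n + v n) ^+ 2 =
          (a * u n - v n) ^+ 2 by ring.
exact: sqr_ge0.
Qed.

HB.instance Definition _ := GRing.isSubmodClosed.Build R (nat -> R)
  square_summable square_summable_submod_closed.

Definition l2 : predArgType := {u : nat -> R | u \in square_summable}.
HB.instance Definition _ := SubChoice.on l2.
HB.instance Definition _ := [SubChoice_isSubLmodule of l2 by <:].

Definition l2_fun (u : l2) : nat -> R := val u.
Coercion l2_fun : l2 >-> Funclass.

Lemma l2P (u : l2) : cvgn (series (fun n => u n ^+ 2)).
Proof. exact/asboolP/(valP u). Qed.

Lemma l2_linear a (u v : l2) n : (a *: u + v : l2) n = a * u n + v n.
Proof. by []. Qed.

Definition l2_form (u v : l2) : R := limn (series (fun n => u n * v n)).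

Lemma l2_form_cvg (u v : l2) : cvgn (series (fun n => u n * v n)).
Proof.
apply: normed_cvg.
have cS := is_cvg_seriesD (@l2P u) (@l2P v).
apply: series_le_cvg cS => n //=; first by rewrite addr_ge0// sqr_ge0.
rewrite !fctE normrM -(real_normK (num_real (u n))) -(real_normK (num_real (v n))).
have := sqr_ge0 (`|u n| - `|v n|); have := normr_ge0 (u n).
have := normr_ge0 (v n); move: `|u n| `|v n| => x y; nra.
Qed.

Lemma l2_formC (u v : l2) : l2_form u v = l2_form v u.
Proof. by rewrite /l2_form; under eq_fun do rewrite mulrC. Qed.

Lemma l2_form_linear (w : l2) : scalar (l2_form^~ w).
Proof.
move=> a u v; rewrite /l2_form.
have uw := @l2_form_cvg u w; have vw := @l2_form_cvg v w.
rewrite (_ : (fun n => _) =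
  a *: (fun n => (u : l2) n * w n) + (fun n => (v : l2) n * w n)); last first.
  by apply/funext => n; rewrite l2_linear mulrDl -mulrA.
by rewrite (lim_seriesD (is_cvg_seriesZ (k := a) uw) vw) lim_seriesZ.
Qed.

Lemma l2_form_bilinear : bilinear_for *%R (idfun \; *%R) l2_form.
Proof.
split=> [u|u] a f g; first exact: l2_form_linear.
by rewrite [LHS]l2_formC l2_form_linear !(l2_formC u).
Qed.

Lemma l2_form_gt0 (u : l2) : u != 0 -> 0 < l2_form u u.
Proof.
move=> u0; have [n un0] : exists n, u n != 0.
  apply: contrapT => /forallNP h; move/eqP: u0; apply.
  by apply: val_inj; apply/funext => n; have /negP := h n; rewrite negbK => /eqP.
have ge0 k : 0 <= u k * u k by rewrite -expr2 sqr_ge0.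
have nd : nondecreasing_seq (series (fun k => u k * u k)).
  by apply: nondecreasing_series => k _ _.
apply: lt_le_trans (nondecreasing_cvgn_le nd (@l2_form_cvg u u) n.+1).
rewrite /series /= big_nat_recr//= ltr_wpDl ?sumr_ge0//.
by rewrite lt_neqAle ge0 andbT eq_sym mulf_neq0.
Qed.

HB.instance Definition _ := bilinear_isBilinear.Build R l2 l2 R *%R
  (idfun \; *%R) l2_form l2_form_bilinear.
HB.instance Definition _ := isHermitianSesquilinear.Build R l2 false idfun
  l2_form (fun u v : l2 => etrans (l2_formC u v) (esym (mul1r _))).
HB.instance Definition _ := isDotProduct.Build R l2 l2_form l2_form_gt0.

Lemma series_fin_supp (F : nat -> R) N : (forall n, (N <= n)%N -> F n = 0) ->
  series F n @[n --> \oo] --> \sum_(n < N) F n.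
Proof.
move=> FN; apply: cvg_near_cst; exists N => // n /= Nn.
rewrite /series /= (big_cat_nat (n := N))//= big_mkord.
by rewrite [X in _ + X]big_nat_cond [X in _ + X]big1 ?addr0// => i /andP[/andP[/FN]].
Qed.

Fact l0_square_summable (f : l0 R) : (f : nat -> R) \in square_summable.
Proof.
have [N fN] := l0P f; apply/asboolP/cvg_ex; exists (\sum_(n < N) f n ^+ 2).
by apply: (@series_fin_supp (fun n => f n ^+ 2)) => n /fN ->; rewrite expr0n.
Qed.

Definition l0_l2 (f : l0 R) : l2 := exist _ (f : nat -> R) (l0_square_summable f).

Lemma l0_l2_formE N (f g : l0 R) : (forall n, (N <= n)%N -> f n = 0) ->
  l2_form (l0_l2 f) (l0_l2 g) = \sum_(n < N) f n * g n.
Proof.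
move=> fN; apply/cvg_lim => //; apply: (@series_fin_supp (fun n => f n * g n)) => n.
by move/fN => ->; rewrite mul0r.
Qed.

End SquareSummable.

(* [T] extends to a unitary map [U] from the completion of [l0] under [form] onto
   [l2]; its adjoint [A] restricts to [S] on finitely supported sequences, and
   the last two clauses are the inversion formulas for the extended transforms. *)
Definition extends_to_unitary (R : realType) (form : {dot l0 R for idfun})
    (T S : l0 R -> l0 R) : Prop :=
  exists (U : {linear completion form -> l2 R})
         (A : {linear l2 R -> completion form}),
    [/\ isometry (@l2_form R) (@comp_form R (l0 R) form) U
          /\ (forall f, exists g, U g = f),
        (forall g, U (embed form g) = l0_l2 (T g)),
        (forall g f, l2_form (U g) f = comp_form g (A f)),
        (forall f, A (l0_l2 f) = embed form (S f)) &
        (forall g, A (U g) = g) /\ (forall f, U (A f) = f)].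

(* The combination of the alternating form with [nabla] as the unitary map and
   [delta] as its adjoint is inconsistent: for the indicator [g] of {0, 1} the
   squared norm of [g] is 1, but that of [nabla g] is 5. *)
Lemma alt_nabla_not_unitary (R : realType) :
  ~ extends_to_unitary (@alt_binomial_form R) (@nabla R) (@delta R).
Proof.
case=> U [A [[Uiso _] Uext _ _ _]].
have gS : (fun n => (n < 2)%:R : R) \in @fin_supp R.
  by apply/fin_suppP; exists 2 => n n2; rewrite ltnNge n2.
pose g : l0 R := exist _ (fun n => (n < 2)%:R) gS.
have gN n : (2 <= n)%N -> g n = 0 by move=> n2; rewrite /g /l0_fun /= ltnNge n2.
have fN n : (2 <= n)%N -> flip g n = 0 by move/gN; rewrite flipE => ->; rewrite mulr0.
have nN n : (2 <= n)%N -> nabla g n = 0.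
  move=> n2; rewrite nablaE (nabla_funE _ gN) big1// => -[x x2] _ /=.
  by rewrite bin_small ?mul0r// (leq_trans x2).
have := Uiso (embed _ g) (embed _ g); rewrite embed_isometry Uext /=.
rewrite (@l0_l2_formE _ 2)// alt_binomial_formE (@binomial_formE _ 2)//.
rewrite !big_ord_recr !big_ord0 /= !nablaE !(nabla_funE _ gN) !(nabla_funE _ fN).
rewrite !big_ord_recr !big_ord0 /= !flipE /g /l0_fun /= ?binn ?bin0 ?bin_small//.
rewrite ?expr0 ?expr1; lra.
Qed.

(* Main.v *)
Require Import Defs.
From HB Require Import structures.
From mathcomp Require Import all_boot all_order all_algebra.
From mathcomp Require Import all_classical all_reals all_analysis.
From mathcomp Require Import lra.
Set Implicit Arguments.
Unset Strict Implicit.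
Unset Printing Implicit Defensive.
Import Order.TTheory GRing.Theory Num.Theory.
Import numFieldNormedType.Exports.
Local Open Scope classical_set_scope.
Local Open Scope ring_scope.

(** The proof has an algebraic part and a Hilbert space part.

    Algebra.  Attach to a finitely supported [f] the polynomial
    [P = \sum_n f n X^n].  By the binomial theorem [flip (nabla f)] has
    polynomial [P(1 - X)], and [X |-> 1 - X] is an involution; since
    [delta = flip \o nabla \o flip], the transforms [nabla] and [delta] are
    inverse to each other ([nablaK], [deltaK]).  The Vandermonde identity for
    the binomial kernel says that [nabla] is isometric from [binomial_form] to
    the l2 product ([binomial_form_nabla]); conjugation by [flip], an isometry
    of l2, turns this into the statement that [delta] is isometric from
    [alt_binomial_form] ([alt_binomial_form_delta]).

    Analysis.  Let [T] be isometric from [form] to the l2 product on finitely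
    supported sequences, with inverse [S].  It is convenient to extend [S]
    first: for [u] in l2 the images under [S] of the truncations of [u] form a
    Cauchy sequence, whose class [synthesis u] depends linearly and
    isometrically on [u].  In the other direction [analysis X] lists the
    coordinates of [X] along the images of the unit sequences; the Bessel
    inequality puts it in l2.  As the images of the unit sequences span a dense
    subspace, [synthesis (analysis X)] and [X], which have the same
    coordinates, are equal, so [analysis] and [synthesis] are inverse
    isometries.  Hence [analysis] is a unitary extension of [T] whose adjoint is
    its inverse [synthesis], an extension of [S]
    ([isometry_extends_to_unitary]).  The theorem is this result for
    [T = nabla], [S = delta] and for [T = delta], [S = nabla]. *)

(** * Inversion of the binomial transforms *)

Section Inversion.
Variable R : realType.
Implicit Types f g : l0 R.

Lemma nabla_bounded f N : (forall n, (N <= n)%N -> f n = 0) ->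
  forall n, (N <= n)%N -> nabla f n = 0.
Proof.
move=> fN n Nn; rewrite nablaE (nabla_funE _ fN) big1// => i _.
by rewrite bin_small ?mul0r// (leq_trans _ Nn).
Qed.

Lemma coef_expr1BX n k : ((1 - 'X : {poly R}) ^+ n)`_k = (-1) ^+ k * 'C(n, k)%:R.
Proof.
rewrite exprBn coef_sum.
under eq_bigr => i _ do
  rewrite expr1n mulr1 coefMn -(rmorphN1 polyC) -rmorphXn/= coefCM coefXn.
have [kn|nk] := leqP k n.
  rewrite (bigD1 (Ordinal (n := n.+1) kn))//= eqxx mulr1 mulr_natr.
  rewrite big1 ?addr0// => i; rewrite -val_eqE /= eq_sym => /negPf ->.
  by rewrite mulr0 mul0rn.
rewrite bin_small// mulr0 big1// => i _.
by rewrite gtn_eqF ?mulr0 ?mul0rn// (leq_trans _ nk).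
Qed.

(** On generating polynomials [flip \o nabla] is the substitution of [1 - X]
    for [X]: this replaces the alternating sums of products of binomial
    coefficients in the inversion formulas. *)
Lemma poly_flip_nabla f N : (forall n, (N <= n)%N -> f n = 0) ->
  \poly_(n < N) flip (nabla f) n = (\poly_(n < N) f n) \Po (1 - 'X).
Proof.
move=> fN; apply/polyP => k; rewrite comp_polyE coef_poly.
(* The composite sums up to the size of the polynomial, which may be below N
   because the last values of f may vanish. *)
rewrite (big_ord_widen _ (fun i => (\poly_(n < N) f n)`_i *: (1 - 'X) ^+ i)
  (size_poly N f)) big_mkcond /= coef_sum.
transitivity (flip (nabla f) k).
  by case: ltnP => // Nk; rewrite flipE (nabla_bounded fN)// mulr0.
rewrite flipE nablaE (nabla_funE _ fN) mulr_sumr; apply: eq_bigr => i _.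
case: ifPn => [_|]; first by rewrite coefZ coef_poly ltn_ord coef_expr1BX mulrA mulrC.
rewrite -leqNgt => /(nth_default 0); rewrite coef_poly ltn_ord => ->.
by rewrite coef0 !mulr0.
Qed.

(** [P(1 - (1 - X)) = P]. *)
Lemma flip_nablaK : involutive (fun f => flip (nabla f)).
Proof.
move=> f; have [N fN] := l0P f.
have gN n : (N <= n)%N -> flip (nabla f) n = 0.
  by move=> Nn; rewrite flipE (nabla_bounded fN)// mulr0.
have hN n : (N <= n)%N -> flip (nabla (flip (nabla f))) n = 0.
  by move=> Nn; rewrite flipE (nabla_bounded gN)// mulr0.
have := poly_flip_nabla gN; rewrite (poly_flip_nabla fN) -comp_polyA.
rewrite comp_polyB comp_polyX comp_polyC.
rewrite opprB addrC subrK comp_polyXr => /polyP ff; apply: l0_inj => n.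
by have := ff n; rewrite !coef_poly; case: ltnP => // Nn _; rewrite fN// hN.
Qed.

Lemma delta_flip f : delta f = flip (nabla (flip f)).
Proof.
apply: l0_inj => n; have [N fN] := l0P f.
rewrite flipE nablaE deltaE (delta_funE _ fN) (@nabla_funE _ _ N); last first.
  by move=> x Nx; rewrite flipE fN// mulr0.
rewrite mulr_sumr; apply: eq_bigr => i _.
by rewrite flipE exprD -!mulrA; congr *%R; rewrite mulrCA.
Qed.

Lemma nablaK : cancel (@nabla R) (@delta R).
Proof. by move=> f; rewrite delta_flip flip_nablaK. Qed.

Lemma deltaK : cancel (@delta R) (@nabla R).
Proof.
by move=> f; rewrite delta_flip -[LHS]flipK (flip_nablaK (flip f)) flipK.
Qed.

Lemma binomial_form_nabla f g :
  binomial_form f g = l2_form (l0_l2 (nabla f)) (l0_l2 (nabla g)).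
Proof.
have [N [fN gN]] := l0_bound2 f g; rewrite (binomial_formE fN gN).
by rewrite (@l0_l2_formE _ N)//; exact: nabla_bounded.
Qed.

Lemma l2_form_flip f g :
  l2_form (l0_l2 (flip f)) (l0_l2 (flip g)) = l2_form (l0_l2 f) (l0_l2 g).
Proof.
congr (limn (series _)); apply/funext => n.
by rewrite -[LHS]/(flip f n * flip g n) !flipE mulrACA -expr2 sqrr_sign mul1r.
Qed.

Lemma alt_binomial_form_delta f g :
  alt_binomial_form f g = l2_form (l0_l2 (delta f)) (l0_l2 (delta g)).
Proof.
by rewrite alt_binomial_formE binomial_form_nabla !delta_flip l2_form_flip.
Qed.

End Inversion.

(** * Truncations and unit sequences *)

Section Truncation.
Variable R : realType.
Implicit Types (u v : nat -> R) (f g : l0 R).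

Fact trunc_fin_supp N u : (fun n => if (n < N)%N then u n else 0) \in @fin_supp R.
Proof. by apply/fin_suppP; exists N => n; rewrite leqNgt => /negPf ->. Qed.

Definition trunc N u : l0 R :=
  exist _ (fun n => if (n < N)%N then u n else 0) (trunc_fin_supp N u).

Lemma truncE N u n : trunc N u n = if (n < N)%N then u n else 0.
Proof. by []. Qed.

Lemma trunc_linear N a u v : trunc N (a *: u + v) = a *: trunc N u + trunc N v.
Proof.
apply: l0_inj => n; rewrite l0_linear !truncE; case: ifP => // _.
by rewrite mulr0 addr0.
Qed.

Lemma trunc_l0 N f : (forall n, (N <= n)%N -> f n = 0) -> trunc N f = f.
Proof.
by move=> fN; apply: l0_inj => n; rewrite truncE; case: ltnP => // /fN ->.
Qed.

(** All inner products of truncations are partial sums of one series; so the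
    Cauchy property and the limits below reduce to the convergence of that
    series. *)
Lemma l2_form_trunc m n u v :
  l2_form (l0_l2 (trunc m u)) (l0_l2 (trunc n v)) =
  series (fun k => u k * v k) (minn m n).
Proof.
rewrite (@l0_l2_formE _ m); last by move=> k; rewrite truncE leqNgt => /negPf ->.
rewrite /series /= big_mkord (big_ord_widen _ (fun k => u k * v k) (geq_minl m n)).
rewrite [RHS]big_mkcond; apply: eq_bigr => k _.
by rewrite !truncE leq_min ltn_ord /=; case: ifP => //; rewrite mulr0.
Qed.

Lemma l2_form_l0 f (v : l2 R) N : (forall n, (N <= n)%N -> f n = 0) ->
  l2_form (l0_l2 f) v = \sum_(n < N) f n * v n.
Proof.
move=> fN; apply/cvg_lim => //; apply: (@series_fin_supp _ (fun n => f n * v n)) => n.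
by move/fN => ->; rewrite mul0r.
Qed.

Definition unit_seq n : l0 R := trunc n.+1 (fun k => (k == n)%:R).

Lemma unit_seqE n k : unit_seq n k = (k == n)%:R.
Proof. by rewrite truncE ltnS; case: ltngtP. Qed.

Lemma l0_sum_unit_seq N f : (forall n, (N <= n)%N -> f n = 0) ->
  f = \sum_(n < N) f n *: unit_seq n.
Proof.
move=> fN; apply: l0_inj => k.
rewrite [RHS](_ : _ = \sum_(n < N) f n * (k == n)%:R); last first.
  rewrite /l0_fun raddf_sum fct_sumE; apply: eq_bigr => n _.
  by rewrite -unit_seqE.
have [kN|Nk] := ltnP k N.
  rewrite (bigD1 (Ordinal kN))//= eqxx mulr1 big1 ?addr0// => n.
  by rewrite -val_eqE /= eq_sym => /negPf ->; rewrite mulr0.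
by rewrite fN// big1// => n _; rewrite gtn_eqF ?mulr0// (leq_trans _ Nk).
Qed.

End Truncation.

(** * Extension of an isometry to the completion *)

(** A vector [X <> 0] is at distance less than its norm from some [embed v]; if
    [X] were orthogonal to [embed v], Cauchy-Schwarz applied to [X] and
    [X - embed v] would give [|X|^2 < |X|^2]. *)
Lemma dense_orthogonal0 (R : realType) (V : lmodType R)
    (form : {dot V for idfun}) (X : completion form) :
  (forall v, comp_form X (embed form v) = 0) -> X = 0.
Proof.
move=> X0; apply/eqP; apply: contraT => /comp_form_gt0 XX.
have nX : 0 < dot_norm (@comp_form R V form) X by rewrite sqrtr_gt0.
have [v Xv] := embed_dense X nX.
have := dot_CauchySchwarz (@comp_form R V form) X (X - embed form v).
rewrite dotBr [X in _ - X](X0 v) subr0 -dot_normE expr2 ler_pM2l//.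
by rewrite leNgt Xv.
Qed.

Section UnitaryExtension.
Variables (R : realType) (V : lmodType R) (form : {dot V for idfun}).
Variable S : {linear l0 R -> V}.
Hypothesis S_isometry :
  forall f g, form (S f) (S g) = l2_form (l0_l2 f) (l0_l2 g).
Hypothesis S_surj : forall v, exists f, S f = v.

Implicit Types (f : l0 R) (X : completion form).
Local Notation cform := (@comp_form R V form).

(** The squared distance between two images is a difference of two partial sums
    of [\sum_n u n ^ 2], and is less than [e ^ 2] once both are within
    [e ^ 2 / 2] of the limit. *)
Fact trunc_cauchy (u : l2 R) : (fun n => S (trunc n u)) \in cauchy_seqs form.
Proof.
apply/asboolP => e e0.
have e2 : 0 < e ^+ 2 / 2 by rewrite divr_gt0// exprn_gt0.
have /cvgrPdist_lt/(_ _ e2)[N _ uN] := @l2P R u.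
exists N => m n Nm Nn.
rewrite -(@ltr_pXn2r _ 2)// ?nnegrE ?dot_norm_ge0 ?(ltW e0)// dot_normE.
rewrite dotBl !dotBr !S_isometry !l2_form_trunc !minnn.
move: (uN m Nm) (uN n Nn) => /=; set l := limn _.
rewrite -[X in series X]/(fun k => u k * u k).
move: (series _ : nat -> R) => s.
rewrite !ltr_norml => /andP[m1 m2] /andP[n1 n2].
by case: (leqP m n) => mn; lra.
Qed.

Definition image_truncs (u : l2 R) : cauchySeq form :=
  exist _ (fun n => S (trunc n u)) (trunc_cauchy u).

(** The sum of the orthogonal series [\sum_n u n * S (unit_seq n)], obtained as
    the class of its partial sums. *)
Definition synthesis (u : l2 R) : completion form := cauchy_class (image_truncs u).

Lemma synthesis_is_linear : linear synthesis.
Proof.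
move=> a u v; rewrite /synthesis -linearP; congr cauchy_class.
apply: val_inj; apply/funext => n /=.
by rewrite -[(_ + _ : nat -> V) n]/(a *: S _ + S _) -linearP -trunc_linear.
Qed.

Lemma synthesis_isometry u v : cform (synthesis u) (synthesis v) = l2_form u v.
Proof.
rewrite -(cvg_lim _ (@comp_form_cvg _ _ _ (image_truncs u) (image_truncs v)))//.
congr (limn _); apply/funext => n /=.
by rewrite S_isometry l2_form_trunc minnn.
Qed.

(** The truncations of a finitely supported sequence are eventually constant. *)
Lemma synthesis_l0 f : synthesis (l0_l2 f) = embed form (S f).
Proof.
have [N fN] := l0P f; apply/class_eq/asboolP; apply: cvg_near_cst.
exists N => // n /= Nn; rewrite -[X in dot_norm _ X]/(S (trunc n f) - S f).
by rewrite trunc_l0 ?subrr ?dot_norm0// => k nk; rewrite fN// (leq_trans Nn).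
Qed.

Definition coord (X : completion form) (n : nat) : R :=
  cform X (embed form (S (unit_seq R n))).

Lemma comp_form_coord X f N : (forall n, (N <= n)%N -> f n = 0) ->
  cform X (embed form (S f)) = \sum_(n < N) f n * coord X n.
Proof.
move=> fN; rewrite {1}(l0_sum_unit_seq fN) !linear_sum linear_sumr.
by apply: eq_bigr => n _; rewrite !linearZ.
Qed.

(** The vector [Y] below is the orthogonal projection of [X] on the span of the
    first [N] basis vectors, so [0 <= |X - Y|^2 = |X|^2 - |Y|^2]. *)
Lemma bessel X N : series (fun n => coord X n ^+ 2) N <= cform X X.
Proof.
set s := series _ N; pose Y := embed form (S (trunc N (coord X))).
have XY : cform X Y = s.
  rewrite (@comp_form_coord _ _ N); last first.
    by move=> k; rewrite truncE leqNgt => /negPf ->.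
  rewrite /s /series /= big_mkord; apply: eq_bigr => n _.
  by rewrite truncE ltn_ord -expr2.
have YY : cform Y Y = s.
  by rewrite [LHS]embed_isometry [LHS]S_isometry l2_form_trunc minnn.
have : 0 <= cform X X - 2 * 1 * cform X Y + 1 ^+ 2 * cform Y Y.
  by rewrite -[leRHS](dotBB cform) dot_ge0.
by rewrite XY YY; lra.
Qed.

Fact coord_square_summable X : coord X \in @square_summable R.
Proof.
apply/asboolP/nondecreasing_is_cvgn.
  by apply: nondecreasing_series => n _ _; exact: sqr_ge0.
by exists (cform X X) => _ [n _ <-]; exact: bessel.
Qed.

Definition analysis (X : completion form) : l2 R :=
  exist _ (coord X) (coord_square_summable X).

Lemma analysis_is_linear : linear analysis.
Proof.
move=> a X Y; apply: val_inj; apply/funext => n.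
rewrite -[RHS]/(a * coord X n + coord Y n) -[LHS]/(coord (a *: X + Y) n).
exact: comp_form_linear.
Qed.

Lemma synthesisK : cancel synthesis analysis.
Proof.
move=> u; apply: val_inj; apply/funext => n; rewrite -[LHS]/(coord (synthesis u) n).
rewrite /coord -synthesis_l0 synthesis_isometry l2_formC.
rewrite (@l2_form_l0 _ _ _ n.+1); last first.
  by move=> k nk; rewrite unit_seqE gtn_eqF.
rewrite (bigD1 ord_max)//= unit_seqE eqxx mul1r big1 ?addr0// => k.
by rewrite -val_eqE /= unit_seqE => /negPf ->; rewrite mul0r.
Qed.

(** The difference of the two sides is orthogonal to every [embed (S f)], and
    these vectors are dense because [S] is onto. *)
Lemma analysisK : cancel analysis synthesis.
Proof.
move=> X; apply/esym/eqP; rewrite -subr_eq0; apply/eqP.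
apply: dense_orthogonal0 => v; have [f <-] := S_surj v; have [N fN] := l0P f.
have fE : cform (synthesis (analysis X)) (embed form (S f)) =
          cform X (embed form (S f)).
  by rewrite (comp_form_coord X fN) -synthesis_l0 synthesis_isometry l2_formC
    (l2_form_l0 _ fN).
by rewrite [LHS](dotBl cform) [X in _ - X]fE subrr.
Qed.

End UnitaryExtension.

Section UnitaryExtensionL0.
Variables (R : realType) (form : {dot l0 R for idfun}).
Variables T S : {linear l0 R -> l0 R}.
Hypothesis T_isometry :
  forall f g, form f g = l2_form (l0_l2 (T f)) (l0_l2 (T g)).
Hypotheses (TK : cancel T S) (SK : cancel S T).

(** Since [synthesis] is isometric and inverse to [analysis], the isometry and
    adjoint properties of [analysis] follow from those of its inverse; and
    [analysis] extends [T] because [embed g = embed (S (T g))] is the value of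
    [synthesis] at [T g]. *)
Lemma isometry_extends_to_unitary : extends_to_unitary form T S.
Proof.
have S_isometry f g : form (S f) (S g) = l2_form (l0_l2 f) (l0_l2 g).
  by rewrite T_isometry !SK.
have S_surj v : exists f, S f = v by exists (T v).
pose Al := GRing.isLinear.Build R _ _ _ _ (synthesis_is_linear S_isometry).
pose Ul := GRing.isLinear.Build R _ _ _ _ (analysis_is_linear S_isometry).
pose A : {linear l2 R -> completion form} := HB.pack (synthesis S_isometry) Al.
pose U : {linear completion form -> l2 R} := HB.pack (analysis S_isometry) Ul.
have AK : cancel A U by exact: synthesisK.
have UK : cancel U A by exact: analysisK.
have Aiso u v : comp_form (A u) (A v) = l2_form u v by exact: synthesis_isometry.
exists U, A; split=> //.
- split=> [X Y|u]; first by rewrite -[LHS]Aiso !UK.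
  by exists (A u).
- by move=> g; rewrite -{1}[g]TK -[embed _ _](synthesis_l0 S_isometry) AK.
- by move=> X u; rewrite -Aiso UK.
- exact: synthesis_l0.
Qed.

End UnitaryExtensionL0.

Theorem theorem4p8 (R : realType) :
  extends_to_unitary (@binomial_form R) (@nabla R) (@delta R) /\
  extends_to_unitary (@alt_binomial_form R) (@delta R) (@nabla R).
Proof.
split.
- exact: (isometry_extends_to_unitary (@binomial_form_nabla R)
    (@nablaK R) (@deltaK R)).
- exact: (isometry_extends_to_unitary (@alt_binomial_form_delta R)
    (@deltaK R) (@nablaK R)).
Qed.
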